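(* Let $1\le p<n$, let $\mathcal Q\in O(n)$ be the orthogonal matrix of the Householder-stabilized coordinate system, let $\Xi\in\mathbb{R}^{(n-p)\times p}$ be the true MV coordinates of a subspace and let $\hat\Xi=\Xi+\Delta$, $\Delta\in\mathbb{R}^{(n-p)\times p}$, be the interpolated coordinates. Let $$P=\mathcal Q\,\widetilde U(\Xi)\widetilde U(\Xi)^T\mathcal Q^T,\qquad \hat P=\mathcal Q\,\widetilde U(\hat\Xi)\widetilde U(\hat\Xi)^T\mathcal Q^T$$ be the corresponding orthogonal projectors. Then $$\|\hat P-P\|_F\le \sqrt2\,\|\widetilde U_1\|_2\,\|\Delta\|_F+\mathcal{O}\big(\|\Xi\|_2\|\Delta\|_F+\|\Delta\|_F^2\big),$$ where $\|\widetilde U_1\|_2$ is the spectral norm of the upper $p\times p$ block $\widetilde U_1$ of the reconstructed Stiefel representative $\widetilde U(\Xi)$. Here the $\mathcal O$-term denotes a quantity bounded by $K\,(\|\Xi\|_2\|\Delta\|_F+\|\Delta\|_F^2)$, where for each $\rho>0$ the constant $K=K(n,p,\rho)$ can be chosen uniformly over all $\Xi,\Delta$ with $\|\Xi\|_2\le \rho$ and $\|\Delta\|_F\le \rho$.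
   Context: $\mathrm{St}(n,p)$ is the set of $n\times p$ real matrices with orthonormal columns; a $p$-dimensional subspace of $\mathbb{R}^n$ is represented by $U\in \mathrm{St}(n,p)$ with column span equal to it, and by the orthogonal projector $UU^T$. Householder-stabilized coordinate system: a reference Stiefel matrix $U_m\in \mathrm{St}(n,p)$ is factorized by Householder QR as $U_m=\mathcal Q\begin{bmatrix}R\\0\end{bmatrix}$ with $\mathcal Q\in O(n)$ and $R\in\mathbb{R}^{p\times p}$ upper triangular. For $U\in \mathrm{St}(n,p)$ write $\mathcal Q^TU=\widetilde U=\begin{bmatrix}\widetilde U_1\\ \widetilde U_2\end{bmatrix}$ with $\widetilde U_1\in\mathbb{R}^{p\times p}$; if $\widetilde U_1$ is invertible, the MV (maximum-volume) coordinates of $\operatorname{span}(U)$ are $\Xi=\widetilde U_2\widetilde U_1^{-1}\in\mathbb{R}^{(n-p)\times p}$. Reconstruction: for $\Xi\in\mathbb{R}^{(n-p)\times p}$, $$\widetilde U(\Xi)=\begin{bmatrix}I_p\\ \Xi\end{bmatrix}(I_p+\Xi^T\Xi)^{-1/2},$$ whose upper block is $(I_p+\Xi^T\Xi)^{-1/2}$. $\|\cdot\|_F$ is the Frobenius norm and $\|\cdot\|_2$ the spectral norm. *)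

(* Defs.v *)
From mathcomp Require Import all_boot all_order all_algebra.
From mathcomp Require Import all_classical all_reals.

Set Implicit Arguments.
Unset Strict Implicit.
Unset Printing Implicit Defensive.

Import Order.TTheory GRing.Theory Num.Theory.
Local Open Scope classical_set_scope.
Local Open Scope ring_scope.

Definition frobenius_norm (R : realType) (m n : nat) (A : 'M[R]_(m, n)) : R :=
  Num.sqrt (\sum_(i < m) \sum_(j < n) A i j ^+ 2).

(* On column vectors the Frobenius norm is the Euclidean norm, so this is the
   operator norm induced by the Euclidean norms. *)
Definition spectral_norm (R : realType) (m n : nat) (A : 'M[R]_(m, n)) : R :=
  sup [set frobenius_norm (A *m x) |
        x in [set x : 'cV[R]_n | frobenius_norm x <= 1]].

Definition stiefel (R : realType) (n p : nat) : set 'M[R]_(n, p) :=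
  [set U | U^T *m U = 1%:M].

Definition orthogonal_group (R : realType) (n : nat) : set 'M[R]_n :=
  [set Q | Q^T *m Q = 1%:M].

(* MathComp's [is_trig_mx] means lower triangular, hence the transpose. *)
Definition upper_triangular (R : realType) (p : nat) (A : 'M[R]_p) : Prop :=
  is_trig_mx A^T.

Definition psdmx (R : realType) (p : nat) : set 'M[R]_p :=
  [set A | A^T = A /\ forall x : 'cV[R]_p, 0 <= (x^T *m A *m x) ord0 ord0].

(* Principal square root: the unique positive semidefinite S with S^2 = A when
   A is positive semidefinite (junk value 0 if there is no such S). *)
Definition sqrtmx (R : realType) (p : nat) (A : 'M[R]_p) : 'M[R]_p :=
  xget 0 [set S | psdmx S /\ S *m S = A].

Definition invsqrtmx (R : realType) (p : nat) (A : 'M[R]_p) : 'M[R]_p :=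
  invmx (sqrtmx A).

(* The ambient dimension is n = p + q throughout, so that an n x p matrix splits
   into its upper p x p block [usubmx] and its lower q x p block [dsubmx]. *)

(* Full QR factorization Um = Q [R; 0] of the reference Stiefel matrix.  The
   Householder algorithm is one way to produce such a Q; no particular choice
   of reflectors or signs is imposed. *)
Definition reference_qr (R : realType) (p q : nat)
    (Um : 'M[R]_(p + q, p)) (Q : 'M[R]_(p + q)) (T : 'M[R]_p) : Prop :=
  [/\ stiefel Um, orthogonal_group Q, upper_triangular T &
      Um = Q *m col_mx T (0 : 'M[R]_(q, p))].

Definition has_mv_coords (R : realType) (p q : nat)
    (Q : 'M[R]_(p + q)) (U : 'M[R]_(p + q, p)) : Prop :=
  usubmx (Q^T *m U) \in unitmx.

Definition mv_coords (R : realType) (p q : nat)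
    (Q : 'M[R]_(p + q)) (U : 'M[R]_(p + q, p)) : 'M[R]_(q, p) :=
  dsubmx (Q^T *m U) *m invmx (usubmx (Q^T *m U)).

Definition stiefel_rep (R : realType) (p q : nat) (Xi : 'M[R]_(q, p)) :
    'M[R]_(p + q, p) :=
  col_mx 1%:M Xi *m invsqrtmx (1%:M + Xi^T *m Xi).

Definition mv_projector (R : realType) (p q : nat)
    (Q : 'M[R]_(p + q)) (Xi : 'M[R]_(q, p)) : 'M[R]_(p + q) :=
  Q *m stiefel_rep Xi *m (stiefel_rep Xi)^T *m Q^T.

(* Main.v *)
Require Import Defs.
From mathcomp Require Import all_boot all_order all_algebra.
From mathcomp Require Import all_classical all_reals.
From mathcomp Require Import spectral complex.
From mathcomp Require Import ring.

Set Implicit Arguments.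
Unset Strict Implicit.
Unset Printing Implicit Defensive.

Import Order.TTheory GRing.Theory Num.Theory.
Local Open Scope ring_scope.

(** The first-order bound holds with no remainder at all: whatever the sizes of
    Xi and Delta, the distance between the projectors is at most
    sqrt 2 * |U1|_2 * |Delta|_F, so K = 0 works.

    Write the projectors as P = U U^T and P' = V V^T, where U and V have
    orthonormal columns and represent Xi and Xi + Delta.  Both projectors have
    trace p, so expanding the square of the symmetric matrix P' - P gives
    |P' - P|_F^2 = 2 |(1 - P') U|_F^2 ([frobenius_norm_projector_sub_sqr]).
    With S = (1 + Xi^T Xi)^(-1/2), which is the upper block of the
    representative of Xi,
      U = Q [1; Xi] S = Q [1; Xi + Delta] S - Q [0; Delta] S.
    The columns of Q [1; Xi + Delta] span the range of P', so 1 - P' kills the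
    first term.  Being a contraction, it leaves at most
    |Q [0; Delta] S|_F = |Delta S|_F <= |S|_2 |Delta|_F.

    This computation needs the principal square root in the definition of the
    representative to be a genuine one, which amounts to the existence of square
    roots of positive semidefinite matrices ([psdmx_has_sqrt]).  The complex
    spectral theorem shows that a real polynomial vanishing at the eigenvalues
    of a real symmetric matrix A annihilates A; hence any polynomial that
    interpolates a fourth root on the eigenvalues takes A to a symmetric fourth
    root of A, whose square is the required root. *)

(** * The Frobenius norm *)

Lemma frobenius_normE (R : realType) m n (A : 'M[R]_(m, n)) :
  frobenius_norm A = Num.sqrt (\tr (A^T *m A)).
Proof.
congr Num.sqrt; rewrite exchange_big; apply: eq_bigr => j _.
by rewrite mxE; apply: eq_bigr => i _; rewrite mxE.
Qed.

Lemma mxtrace_gram_ge0 (R : realType) m n (A : 'M[R]_(m, n)) :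
  0 <= \tr (A^T *m A).
Proof.
apply: sumr_ge0 => j _; rewrite mxE; apply: sumr_ge0 => i _.
by rewrite mxE -expr2 sqr_ge0.
Qed.

Lemma frobenius_norm_ge0 (R : realType) m n (A : 'M[R]_(m, n)) :
  0 <= frobenius_norm A.
Proof. exact: sqrtr_ge0. Qed.

Lemma frobenius_norm_sqr (R : realType) m n (A : 'M[R]_(m, n)) :
  frobenius_norm A ^+ 2 = \tr (A^T *m A).
Proof. by rewrite frobenius_normE sqr_sqrtr ?mxtrace_gram_ge0. Qed.

Lemma frobenius_norm_sqr_sum (R : realType) m n (A : 'M[R]_(m, n)) :
  frobenius_norm A ^+ 2 = \sum_i \sum_j A i j ^+ 2.
Proof.
rewrite sqr_sqrtr //; apply: sumr_ge0 => i _; apply: sumr_ge0 => j _.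
exact: sqr_ge0.
Qed.

Lemma frobenius_norm_trmx (R : realType) m n (A : 'M[R]_(m, n)) :
  frobenius_norm A^T = frobenius_norm A.
Proof. by rewrite !frobenius_normE trmxK mxtrace_mulC. Qed.

Lemma frobenius_normZ (R : realType) m n a (A : 'M[R]_(m, n)) :
  frobenius_norm (a *: A) = `|a| * frobenius_norm A.
Proof.
rewrite !frobenius_normE [(_ *: A)^T]linearZ /= -scalemxAl -scalemxAr !mxtraceZ mulrA.
by rewrite -expr2 sqrtrM ?sqr_ge0 // sqrtr_sqr.
Qed.

Lemma frobenius_norm0 (R : realType) m n :
  frobenius_norm (0 : 'M[R]_(m, n)) = 0.
Proof. by rewrite -(scale0r 0) frobenius_normZ normr0 mul0r. Qed.

Lemma frobenius_norm_eq0 (R : realType) m n (A : 'M[R]_(m, n)) :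
  frobenius_norm A = 0 -> A = 0.
Proof.
move=> A0; apply/matrixP => i j; rewrite mxE; apply/eqP.
have := frobenius_norm_sqr_sum A; rewrite A0 expr0n => /esym/eqP.
rewrite psumr_eq0 => [/allP/(_ i (mem_index_enum _))/=|k _]; last first.
  by apply: sumr_ge0 => l _; exact: sqr_ge0.
rewrite psumr_eq0 => [/allP/(_ j (mem_index_enum _))/=|l _]; last exact: sqr_ge0.
by rewrite sqrf_eq0.
Qed.

(** * The spectral norm as an operator norm *)

Lemma frobenius_norm_cV_ge_entry (R : realType) n (x : 'cV[R]_n) j :
  `|x j ord0| <= frobenius_norm x.
Proof.
rewrite -(ler_pXn2r (n := 2)) ?nnegrE ?frobenius_norm_ge0 //.
rewrite frobenius_norm_sqr_sum real_normK ?num_real // (bigD1 j) //= big_ord1.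
rewrite lerDl; apply: sumr_ge0 => i _; apply: sumr_ge0 => k _; exact: sqr_ge0.
Qed.

(** The supremum defining the spectral norm carries no information until the
    set is known to be bounded.  On the unit ball every coordinate is at most 1
    in absolute value, so the row sums of absolute values give a crude bound. *)
Lemma spectral_norm_has_ubound (R : realType) m n (A : 'M[R]_(m, n)) :
  has_ubound [set frobenius_norm (A *m x) |
              x in [set x : 'cV[R]_n | frobenius_norm x <= 1]]%classic.
Proof.
exists (Num.sqrt (\sum_i (\sum_j `|A i j|) ^+ 2)) => _ [x /= x1 <-].
apply: ler_wsqrtr; apply: ler_sum => i _; rewrite big_ord1 mxE.
rewrite -(real_normK (num_real (\sum_j _))) ler_pXn2r ?nnegrE ?sumr_ge0 //.
apply: (le_trans (ler_norm_sum _ _ _)); apply: ler_sum => j _.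
rewrite normrM ler_piMr //.
exact: le_trans (frobenius_norm_cV_ge_entry x j) x1.
Qed.

Lemma spectral_norm_ge0 (R : realType) m n (A : 'M[R]_(m, n)) :
  0 <= spectral_norm A.
Proof.
apply: le_trans (frobenius_norm_ge0 (A *m (0 : 'cV_n))) _.
apply: ub_le_sup; first exact: spectral_norm_has_ubound.
by exists 0; rewrite //= frobenius_norm0 ler01.
Qed.

Lemma frobenius_norm_mul_cV (R : realType) m n (A : 'M[R]_(m, n)) (x : 'cV_n) :
  frobenius_norm (A *m x) <= spectral_norm A * frobenius_norm x.
Proof.
have [/frobenius_norm_eq0 ->|x0] := eqVneq (frobenius_norm x) 0.
  by rewrite mulmx0 !frobenius_norm0 mulr0.
have xp : 0 < frobenius_norm x by rewrite lt_def x0 frobenius_norm_ge0.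
rewrite -ler_pdivrMr // mulrC.
rewrite -[(_ x)^-1]ger0_norm ?invr_ge0 ?frobenius_norm_ge0 // -frobenius_normZ.
apply: ub_le_sup; first exact: spectral_norm_has_ubound.
exists ((frobenius_norm x)^-1 *: x); last by rewrite scalemxAr.
by rewrite /= frobenius_normZ normfV ger0_norm ?mulVf // frobenius_norm_ge0.
Qed.

(** The squared Frobenius norm is the sum over the columns of their squared
    Euclidean norms, and [A] acts on each column separately. *)
Lemma frobenius_norm_mulmx (R : realType) m n k
    (A : 'M[R]_(m, n)) (B : 'M[R]_(n, k)) :
  frobenius_norm (A *m B) <= spectral_norm A * frobenius_norm B.
Proof.
have colsE p (C : 'M[R]_(p, k)) :
    frobenius_norm C ^+ 2 = \sum_j frobenius_norm (col j C) ^+ 2.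
  rewrite frobenius_norm_sqr_sum exchange_big; apply: eq_bigr => j _.
  rewrite frobenius_norm_sqr_sum; apply: eq_bigr => i _.
  by rewrite big_ord1 mxE.
rewrite -(ler_pXn2r (n := 2)) ?nnegrE ?mulr_ge0 ?frobenius_norm_ge0
  ?spectral_norm_ge0 //.
rewrite exprMn !colsE mulr_sumr; apply: ler_sum => j _.
rewrite -exprMn colE -mulmxA -colE ler_pXn2r ?nnegrE ?mulr_ge0 ?frobenius_norm_ge0
  ?spectral_norm_ge0 //.
exact: frobenius_norm_mul_cV.
Qed.

(** * Orthogonal projectors *)

Lemma frobenius_norm_isometry (R : realType) m n k
    (V : 'M[R]_(m, n)) (A : 'M[R]_(n, k)) :
  stiefel V -> frobenius_norm (V *m A) = frobenius_norm A.
Proof.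
move=> VV; rewrite !frobenius_normE trmx_mul -mulmxA [V^T *m _]mulmxA.
by rewrite [V^T *m V]VV mul1mx.
Qed.

(** Pythagoras: [V *m V^T] is the orthogonal projector on the range of [V].  In
    particular, taking the residual is a contraction. *)
Lemma frobenius_norm_residual_sqr (R : realType) m n k
    (V : 'M[R]_(m, n)) (A : 'M[R]_(m, k)) :
  stiefel V ->
  frobenius_norm (A - V *m V^T *m A) ^+ 2
    = frobenius_norm A ^+ 2 - frobenius_norm (V^T *m A) ^+ 2.
Proof.
move=> VV; rewrite !frobenius_norm_sqr.
rewrite [(_ - _)^T]linearB /= !trmx_mul !trmxK mulmxBl !mulmxBr !mulmxA.
rewrite -[_ *m V^T *m V]mulmxA [V^T *m V]VV mulmx1 subrr subr0.
by rewrite raddfB.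
Qed.

(** Projectors of equal rank [n] have equal trace, so the two halves of the gap,
    the part of the range of [U] outside that of [V] and vice versa, contribute
    equally: both squares are [n - |V^T U|^2]. *)
Lemma frobenius_norm_projector_sub_sqr (R : realType) m n
    (V U : 'M[R]_(m, n)) :
  stiefel V -> stiefel U ->
  frobenius_norm (V *m V^T - U *m U^T) ^+ 2
    = 2 * frobenius_norm (U - V *m V^T *m U) ^+ 2.
Proof.
move=> VV UU; rewrite frobenius_norm_residual_sqr //.
have tr1 (W : 'M[R]_(m, n)) : stiefel W -> \tr (W *m W^T *m (W *m W^T)) = n%:R.
  move=> WW; rewrite mulmxA -[_ *m W^T *m W]mulmxA [W^T *m W]WW mulmx1.
  by rewrite mxtrace_mulC [W^T *m W]WW mxtrace1.
rewrite !frobenius_norm_sqr [U^T *m U]UU mxtrace1.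
rewrite [(_ - _)^T]linearB /= !trmx_mul !trmxK mulmxBl !mulmxBr !raddfB /= !tr1 //.
rewrite (mxtrace_mulC (U *m U^T)).
have -> : \tr (U^T *m V *m (V^T *m U)) = \tr (V *m V^T *m (U *m U^T)).
  by rewrite -mulmxA mxtrace_mulC !mulmxA.
ring.
Qed.

(** * Square roots of positive semidefinite matrices *)

(** Newton's form of interpolation: the correction added for a new node [a] is a
    multiple of the polynomial that vanishes at all previous nodes.  A repeated
    node needs no correction, so [rs] may have duplicates. *)
Lemma exists_interpolation (F : fieldType) (rs : seq F) (f : F -> F) :
  exists g : {poly F}, forall x, x \in rs -> g.[x] = f x.
Proof.
elim: rs => [|a rs [g gf]]; first by exists 0.
have [ars|ars] := boolP (a \in rs).
  by exists g => x; rewrite inE => /predU1P[->|]; exact: gf.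
pose w := \prod_(y <- rs) ('X - y%:P).
have wa : w.[a] != 0 by rewrite -[_ == 0]/(root w a) root_prod_XsubC.
exists (g + ((f a - g.[a]) / w.[a]) *: w) => x; rewrite inE !hornerE.
case/predU1P => [->|xrs]; first by rewrite divfK // addrC subrK.
have /rootP -> : root w x by rewrite root_prod_XsubC.
by rewrite mulr0 addr0 gf.
Qed.

(** Over the complex numbers, [A] is hermitian, hence unitarily similar to a
    diagonal matrix with real entries.  These entries are eigenvalues of [A] over
    the reals too, since being a root of the characteristic polynomial does not
    depend on the field; and [horner_mx A h] is similar to the diagonal matrix
    of the values of [h] at them. *)
Lemma symmetric_horner_mx_eq0 (R : realType) n (A : 'M[R]_n.+1) :
  A^T = A -> exists rs : seq R, {in rs, forall x, eigenvalue A x} /\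
    forall h : {poly R}, {in rs, forall x, root h x} -> horner_mx A h = 0.
Proof.
move=> symA; pose toC := real_complex R; pose B := map_mx toC A.
have hermB : B \is hermsymmx.
  apply: realsym_hermsym.
    by apply/is_hermitianmxP; rewrite expr0 scale1r map_mx_id // /B map_trmx symA.
  by apply/mxOverP => i j; rewrite mxE complex_real.
have /orthomx_spectralP BE := hermitian_normalmx hermB.
have Dreal := hermitian_spectral_diag_real hermB.
set P := spectralmx B in BE; set D := spectral_diag B in BE Dreal.
have Pu : P \in unitmx := spectral_unit B.
pose d i := complex.Re (D ord0 i).
have dD i : toC (d i) = D ord0 i.
  by apply: RRe_real; move/mxOverP: Dreal; apply.
exists (codom d); split=> [_ /codomP[i ->]|h hrs].
  suff: eigenvalue B (toC (d i)).
    by rewrite !eigenvalue_root_char -map_char_poly fmorph_root.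
  rewrite dD; apply/eigenvalueP; exists (row i P).
    rewrite -row_mul -/B BE !mulmxA mulmxV // mul1mx.
    by rewrite row_mul row_diag_mx -scalemxAl -rowE.
  (* a zero row would contradict the invertibility of [P] *)
  apply/eqP => Pi0; have /matrixP/(_ 0 i)/eqP : delta_mx 0 i = 0 :> 'rV[R[i]]_n.+1.
    by rewrite -[LHS](mulmxK Pu) -rowE Pi0 mul0mx.
  by rewrite !mxE !eqxx oner_eq0.
apply: (map_mx_inj (f := toC)); rewrite map_horner_mx -/B BE.
rewrite horner_mx_uconjC // horner_mx_diag.
have -> : map_mx (horner (map_poly toC h)) D = 0.
  apply/rowP => i; rewrite !mxE -dD horner_map.
  by have /rootP -> := hrs _ (codom_f d i); rewrite rmorph0.
by rewrite raddf0 mulmx0 mul0mx map_mx0.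
Qed.

Lemma psdmx_eigenvalue_ge0 (R : realType) n (A : 'M[R]_n) x :
  psdmx A -> eigenvalue A x -> 0 <= x.
Proof.
move=> [_ posA] /eigenvalueP[v vA v0].
have := posA v^T; rewrite trmxK vA -scalemxAl mxE.
have -> : (v *m v^T) ord0 ord0 = frobenius_norm v^T ^+ 2.
  by rewrite frobenius_norm_sqr trmxK /mxtrace big_ord1.
rewrite pmulr_lge0 // exprn_gt0 // lt_def frobenius_norm_ge0 andbT.
by apply: contraNneq v0; rewrite frobenius_norm_trmx => /frobenius_norm_eq0 ->.
Qed.

Lemma trmx_horner_mx (R : comNzRingType) n (A : 'M[R]_n.+1) (h : {poly R}) :
  (horner_mx A h)^T = horner_mx A^T h.
Proof.
elim/poly_ind: h => [|h c IH]; first by rewrite !rmorph0 trmx0.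
rewrite !(rmorphD, rmorphM) /= !horner_mx_X !horner_mx_C linearD /= tr_scalar_mx.
rewrite -[horner_mx A h * A]/(horner_mx A h *m A) trmx_mul IH.
by congr (_ + _); apply: comm_mx_horner.
Qed.

Lemma gram_psdmx (R : realType) m n (A : 'M[R]_(m, n)) : psdmx (A^T *m A).
Proof.
split=> [|x]; first by rewrite trmx_mul trmxK.
have -> : (x^T *m (A^T *m A) *m x) ord0 ord0 = frobenius_norm (A *m x) ^+ 2.
  by rewrite frobenius_norm_sqr trmx_mul /mxtrace big_ord1 !mulmxA.
exact: sqr_ge0.
Qed.

(** Interpolating a fourth root instead of a square root makes positivity
    immediate: the square root is the square of a symmetric matrix, that is, a
    Gram matrix. *)
Lemma psdmx_has_sqrt (R : realType) n (A : 'M[R]_n) :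
  psdmx A -> exists S, psdmx S /\ S *m S = A.
Proof.
case: n A => [|n] A psdA.
  by exists A; split; rewrite // [LHS]flatmx0 [RHS]flatmx0.
have symA := psdA.1.
have [rs [eigA annA]] := symmetric_horner_mx_eq0 symA.
have [g gE] := exists_interpolation rs (fun x => Num.sqrt (Num.sqrt x)).
have symG : (horner_mx A g)^T = horner_mx A g by rewrite trmx_horner_mx symA.
exists ((horner_mx A g)^T *m horner_mx A g); split; first exact: gram_psdmx.
rewrite symG; apply/eqP; rewrite -subr_eq0.
have -> : horner_mx A g *m horner_mx A g *m (horner_mx A g *m horner_mx A g) - A
        = horner_mx A (g ^+ 4 - 'X).
  by rewrite rmorphB rmorphXn /= horner_mx_X (exprM _ 2 2) !expr2.
apply/eqP/annA => x xrs; rewrite rootE !hornerE gE //.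
rewrite (exprM _ 2 2) !sqr_sqrtr ?sqrtr_ge0 ?subrr //.
exact: psdmx_eigenvalue_ge0 psdA (eigA x xrs).
Qed.

Lemma sqrtmxP (R : realType) n (A : 'M[R]_n) :
  psdmx A -> psdmx (sqrtmx A) /\ sqrtmx A *m sqrtmx A = A.
Proof. move=> /psdmx_has_sqrt; exact: (xgetPex 0). Qed.

(** * The reconstructed Stiefel representative *)

Lemma add1_gram_psdmx (R : realType) p q (Xi : 'M[R]_(q, p)) :
  psdmx (1%:M + Xi^T *m Xi).
Proof.
have -> : 1%:M + Xi^T *m Xi = (col_mx 1%:M Xi)^T *m col_mx 1%:M Xi.
  by rewrite tr_col_mx mul_row_col trmx1 mul1mx.
exact: gram_psdmx.
Qed.

(** If [v] is in the kernel, then [|v|^2 + |Xi v^T|^2 = 0]. *)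
Lemma add1_gram_unitmx (R : realType) p q (Xi : 'M[R]_(q, p)) :
  1%:M + Xi^T *m Xi \in unitmx.
Proof.
rewrite -row_free_unit -kermx_eq0; apply/rowV0P => v /sub_kermxP.
move=> /(congr1 (mulmx^~ v^T)) /(congr1 mxtrace).
rewrite mul0mx mxtrace0 mulmxDr mulmx1 mulmxDl raddfD /= => vGv.
have E : frobenius_norm v^T ^+ 2 + frobenius_norm (Xi *m v^T) ^+ 2 = 0.
  by rewrite !frobenius_norm_sqr trmxK trmx_mul trmxK -[RHS]vGv !mulmxA.
move/eqP: E; rewrite paddr_eq0 ?sqr_ge0 // => /andP[/eqP v0 _].
move: v0 => /eqP; rewrite sqrf_eq0 => /eqP/frobenius_norm_eq0 v0.
by rewrite -[v]trmxK v0 trmx0.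
Qed.

Lemma sqrtmx_add1_gram_unitmx (R : realType) p q (Xi : 'M[R]_(q, p)) :
  sqrtmx (1%:M + Xi^T *m Xi) \in unitmx.
Proof.
have := add1_gram_unitmx Xi; have [_ {1}<-] := sqrtmxP (add1_gram_psdmx Xi).
by rewrite unitmx_mul andbb.
Qed.

Lemma trmx_invsqrtmx_add1_gram (R : realType) p q (Xi : 'M[R]_(q, p)) :
  (invsqrtmx (1%:M + Xi^T *m Xi))^T = invsqrtmx (1%:M + Xi^T *m Xi).
Proof. by rewrite trmx_inv; have [[-> _] _] := sqrtmxP (add1_gram_psdmx Xi). Qed.

Lemma stiefel_rep_stiefel (R : realType) p q (Xi : 'M[R]_(q, p)) :
  stiefel (stiefel_rep Xi).
Proof.
have [_ SS] := sqrtmxP (add1_gram_psdmx Xi).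
rewrite /stiefel /= /stiefel_rep trmx_mul trmx_invsqrtmx_add1_gram.
rewrite mulmxA -[_ *m _ *m col_mx _ _]mulmxA tr_col_mx mul_row_col trmx1 mul1mx.
rewrite -{2}SS mulmxA mulVmx ?sqrtmx_add1_gram_unitmx // mul1mx.
by rewrite mulmxV ?sqrtmx_add1_gram_unitmx.
Qed.

Lemma usubmx_stiefel_rep (R : realType) p q (Xi : 'M[R]_(q, p)) :
  usubmx (stiefel_rep Xi) = invsqrtmx (1%:M + Xi^T *m Xi).
Proof. by rewrite /stiefel_rep mul_col_mx col_mxKu mul1mx. Qed.

Lemma stiefel_mul (R : realType) m n k (V : 'M[R]_(m, n)) (U : 'M[R]_(n, k)) :
  stiefel V -> stiefel U -> stiefel (V *m U).
Proof.
move=> VV UU; rewrite /stiefel /= trmx_mul -mulmxA [V^T *m _]mulmxA.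
by rewrite [V^T *m V]VV mul1mx.
Qed.

(** * The perturbation bound *)

(** A global Lipschitz estimate for the map from coordinates to projectors: the
    residual [(1 - V V^T) U] sees only the displacement [Q [0; Delta] S], because
    the unperturbed frame differs from one spanning the range of [V] by exactly
    that. *)
Lemma mv_projector_lipschitz (R : realType) p q (Q : 'M[R]_(p + q))
    (Xi Delta : 'M[R]_(q, p)) :
  orthogonal_group Q ->
  frobenius_norm (mv_projector Q (Xi + Delta) - mv_projector Q Xi)
    <= Num.sqrt 2 * spectral_norm (usubmx (stiefel_rep Xi))
         * frobenius_norm Delta.
Proof.
move=> QQ; rewrite usubmx_stiefel_rep.
set S := invsqrtmx _.
pose V := Q *m stiefel_rep (Xi + Delta); pose U := Q *m stiefel_rep Xi.
have VV : stiefel V by apply: stiefel_mul; last exact: stiefel_rep_stiefel.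
have UU : stiefel U by apply: stiefel_mul; last exact: stiefel_rep_stiefel.
have projE X : mv_projector Q X = Q *m stiefel_rep X *m (Q *m stiefel_rep X)^T.
  by rewrite /mv_projector [(Q *m _)^T]trmx_mul !mulmxA.
(* [U] is split into a part [V *m C] in the range of the perturbed projector and
   the displacement [M]. *)
pose M := Q *m col_mx 0 Delta *m S.
pose C := sqrtmx (1%:M + (Xi + Delta)^T *m (Xi + Delta)) *m S.
have UE : U = V *m C - M.
  rewrite /U /V /C /M /stiefel_rep -/S -!mulmxA -mulmxBr; congr (_ *m _).
  rewrite [invsqrtmx _ *m _]mulmxA mulVmx ?sqrtmx_add1_gram_unitmx // mul1mx.
  by rewrite -mulmxBl; congr (_ *m _); rewrite opp_col_mx add_col_mx subr0 addrK.
have resE : U - V *m V^T *m U = - (M - V *m V^T *m M).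
  rewrite UE -!(mulmxA V) (mulmxBr V^T) (mulmxA V^T V) [V^T *m V]VV mul1mx.
  by rewrite mulmxBr !opprB addrC addrA subrK.
have MS : frobenius_norm M <= spectral_norm S * frobenius_norm Delta.
  rewrite /M -mulmxA frobenius_norm_isometry // mul_col_mx mul0mx.
  have -> : frobenius_norm (col_mx (0 : 'M_p) (Delta *m S))
          = frobenius_norm (Delta *m S).
    by rewrite !frobenius_normE tr_col_mx mul_row_col mulmx0 add0r.
  (* [S] multiplies on the right; as it is symmetric, transposing moves it to the
     left *)
  rewrite -frobenius_norm_trmx trmx_mul trmx_invsqrtmx_add1_gram -/S.
  by rewrite -[frobenius_norm Delta]frobenius_norm_trmx frobenius_norm_mulmx.
rewrite !projE -/V -/U -mulrA.
rewrite -(ler_pXn2r (n := 2)) ?nnegrE ?mulr_ge0 ?sqrtr_ge0 ?frobenius_norm_ge0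
  ?spectral_norm_ge0 //.
rewrite frobenius_norm_projector_sub_sqr // resE -scaleN1r frobenius_normZ.
rewrite normrN1 mul1r frobenius_norm_residual_sqr // exprMn.
rewrite [Num.sqrt 2 ^+ 2]sqr_sqrtr //.
rewrite ler_pM2l //; apply: le_trans (_ : frobenius_norm M ^+ 2 <= _).
  by rewrite gerBl sqr_ge0.
by rewrite ler_pXn2r ?nnegrE ?mulr_ge0 ?frobenius_norm_ge0 ?spectral_norm_ge0.
Qed.

Theorem theorem1 (R : realType) (p q : nat) (hp : (0 < p)%N) (hq : (0 < q)%N)
    (rho : R) (hrho : 0 < rho) :
  exists K : R,
    forall (Um : 'M[R]_(p + q, p)) (Q : 'M[R]_(p + q)) (T : 'M[R]_p),
      reference_qr Um Q T ->
    forall (U : 'M[R]_(p + q, p)) (Xi Delta : 'M[R]_(q, p)),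
      stiefel U -> has_mv_coords Q U -> Xi = mv_coords Q U ->
      spectral_norm Xi <= rho -> frobenius_norm Delta <= rho ->
      frobenius_norm (mv_projector Q (Xi + Delta) - mv_projector Q Xi)
        <= Num.sqrt 2 * spectral_norm (usubmx (stiefel_rep Xi))
             * frobenius_norm Delta
           + K * (spectral_norm Xi * frobenius_norm Delta
                  + frobenius_norm Delta ^+ 2).
Proof.
exists 0 => Um Q T [_ QQ _ _] U Xi Delta _ _ _ _ _.
rewrite mul0r addr0; exact: mv_projector_lipschitz.
Qed.
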